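(* Let $q$ be a prime power and let $x\in\{0,1,q,q+1,q+2,2q,2q+1,2q+2\}$. Then there exist two maximum scattered linear sets in $\mathrm{PG}(1,q^3)$ which meet in exactly $x$ points, with the following excepted pairs $(q,x)$: $x\in\{0,1,2,3,4\}$ when $q=2$; $x\in\{1,3\}$ when $q=3$; and $x=4$ when $q=4$. (The claim is existence for all non-excepted pairs.)
   Context: Field reduction: the points of $\mathrm{PG}(1,q^3)$ are the $1$-dimensional $\mathbb{F}_{q^3}$-subspaces of $\mathbb{F}_{q^3}^2$. Viewing $\mathbb{F}_{q^3}^2$ as a $6$-dimensional $\mathbb{F}_q$-space, they become the planes of a regular (Desarguesian) $2$-spread $\mathcal{S}$ of $\mathrm{PG}(5,q)$. For a plane $\pi$ of $\mathrm{PG}(5,q)$, $B(\pi)$ denotes the set of points $X$ of $\mathrm{PG}(1,q^3)$ whose corresponding spread plane meets $\pi$. If $\pi$ is a plane of $\mathrm{PG}(5,q)$ not in $\mathcal{S}$ that meets $q^2+q+1$ planes of $\mathcal{S}$, then $B(\pi)$ has size $q^2+q+1$ and is called a maximum scattered linear set. *)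

(* Defs.v *)
From HB Require Import structures.
From mathcomp Require Import all_boot all_algebra all_field.

Set Implicit Arguments.
Unset Strict Implicit.
Unset Printing Implicit Defensive.

Import GRing.Theory.

Section FinVspace.

Variables (K : finFieldType) (vT : vectType K).

HB.instance Definition _ := isCountable.Build {vspace vT}
  (pcan_pickleK (can_pcan (@VectorInternalTheory.vs2mxK K vT))).
HB.instance Definition _ := isFinite.Build {vspace vT}
  (pcan_enumP (can_pcan (@VectorInternalTheory.vs2mxK K vT))).

End FinVspace.

Section FieldReduction.

Variables (F : finFieldType) (L : fieldExtType F).

(* [finvect_type L] is L itself, equipped with its finite field structure.
   L ^ 2 occurs twice, with the same vectors: [L2] is the L-space (dimension 2)
   and [V6] is the F-space (dimension 6 when [L : F] = 3). *)
Definition L2 : vectType (finvect_type L) :=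
  ((finvect_type L)^o * (finvect_type L)^o)%type.
Definition V6 : vectType F := (finvect_type L * finvect_type L)%type.

Definition PG1 : finType := {X : {vspace L2} | \dim X == 1}.

(* The F-span of the vectors of X; it adds no vector, see [mem_spread_elt]. *)
Definition spread_elt (X : PG1) : {vspace V6} :=
  <<enum [pred v : finvect_type L * finvect_type L | (v : L2) \in val X]>>%VS.

Definition desarguesian_spread : {set {vspace V6}} :=
  [set spread_elt X | X in [set: PG1]].

(* Projective subspaces meet when they share a point, i.e. a nonzero vector. *)
Definition meets (U W : {vspace V6}) : bool := (U :&: W != 0)%VS.

Definition linear_set (pi : {vspace V6}) : {set PG1} :=
  [set X | meets (spread_elt X) pi].

Definition max_scattered_linear_set (A : {set PG1}) : Prop :=
  exists pi : {vspace V6},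
    [/\ \dim pi = 3,
        pi \notin desarguesian_spread,
        #|[set U in desarguesian_spread | meets U pi]| = #|F| ^ 2 + #|F| + 1
      & A = linear_set pi].

Lemma mem_spread_elt (X : PG1) (v : V6) :
  (v \in spread_elt X) = ((v : L2) \in val X).
Proof.
apply/idP/idP => [vX|vX]; last by apply: memv_span; rewrite mem_enum.
have memZ (a : F) (w : V6) : (w : L2) \in val X -> ((a *: w)%R : L2) \in val X.
  move=> wX.
  have -> : (a *: w = (a%:A : finvect_type L) *: (w : L2) :> L2)%R.
    case: w wX => w1 w2 _; congr pair; apply/esym.
      exact: (mulr_algl a (w1 : finvect_type L)).
    exact: (mulr_algl a (w2 : finvect_type L)).
  exact: memvZ.
rewrite (coord_span (X := in_tuple _) vX).
apply: (big_ind (fun u : V6 => (u : L2) \in val X)) => [|u w|i _].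
- exact: mem0v.
- exact: memvD.
apply: memZ; set e := enum _.
have : nth 0%R e i \in e by apply: mem_nth.
by rewrite mem_enum.
Qed.

End FieldReduction.

(* Main.v *)
From HB Require Import structures.
Require Import Defs.
From mathcomp Require Import all_boot all_algebra all_field.
From mathcomp Require Import ring zify.

(** Points of PG(1,L), with [L : F] = 3 and |F| = q, are slopes: an element of L
or infinity.  A plane pi of PG(5,q) is given by a 3-dimensional F-subspace of
L x L, and B(pi) is the set of slopes of its nonzero vectors.  Call pi
scattered if two of its vectors that are proportional over L are proportional
over F.  Then every point of B(pi) is the slope of exactly q - 1 vectors, so
|B(pi)| = (q^3 - 1) / (q - 1) = q^2 + q + 1 [card_scattered]; this is all that
is needed for B(pi) to be a maximum scattered linear set [scattered_max].

If 1, w0, w1 is an F-basis of L, the span of (1,0), (0,1), (w0,w1) is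
scattered [scattered_plane]: cross-multiplying two proportional vectors gives a
relation between 1, w0, w1 whose coefficients are the 2 x 2 minors of their
coordinates.  Its slopes are infinity, the r, and the (w0 + r) / (w1 + s), with
r and s in F, and z |-> c z + b maps it to another scattered plane.  All the
pairs except disjoint ones consist of two such planes.

Intersections 2q, 2q + 1, 2q + 2.  Take both planes through F x F, so that they
share the q + 1 points of PG(1,F), with (u0,u1) = (a w0 + b w1, c w0 + d w1) in
the second one.  Comparing F-coordinates in
  (w0 + r) (u1 + s') = (w1 + s) (u0 + r')
determines r' and s' linearly and leaves an affine conic in (r,s) whose leading
form is c r^2 + (d - a) r s - b s^2.  It has q - 1, q or q + 1 affine points
according as this form splits, is a square, or is irreducible
[share_2q, share_2q_plus1, share_2q_plus2].

Intersections 1, q, q + 1, q + 2.  Take B = c A + b with c in F and b outside F.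
Both contain infinity.  In
  (w0 + r) / (w1 + s) = c (w0 + r') / (w1 + s') + b
one of the three F-coordinates is an equation between s and s' only: it says
that s' is the image of s under a projectivity of the projective line over F,
where the parameter s = infinity stands for the slopes r.
The two others determine r and r' from s and s' by a linear system of
determinant s' - s.  So every s that is not fixed gives one common point, and
with b suitably chosen a fixed one gives none: the sets share q + 2 - R points
when the projectivity has R fixed points.  The values R = 1, 2, q + 1 come from
a triangular matrix [share_triangular], and R = 0 from a matrix without
eigenvectors [share_q_plus2].

Disjoint pairs.  The planes {(lam x^q, x)} have slopes lam x^(q-1), so those
for lam = 1 and lam are disjoint unless lam is a (q-1)-st power; for q > 2 not
every element of L is one [realized_0].

For q = 3 the four common points (q + 1) are found with a multiplier c outside
F [share_4].  Since 2q + 2 < q^2 + q + 1, the two sets are always different. *)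

Set Implicit Arguments.
Unset Strict Implicit.
Unset Printing Implicit Defensive.

Import GRing.Theory.

(** * Common slopes of two planes *)

Section Slopes.

Local Open Scope ring_scope.

Variables (F : finFieldType) (E : fieldType) (i : {rmorphism F -> E}).
Local Notation q := #|F|.

(** Independence over F together with 1: in a cubic extension, 1, w0, w1 is then
an F-basis. *)
Definition indep (w0 w1 : E) : Prop :=
  forall r s t : F, i r + i s * w0 + i t * w1 = 0 -> [/\ r = 0, s = 0 & t = 0].

(** The points of the image, under z |-> c z + b, of the linear set of the plane
spanned by (1,0), (0,1), (w0,w1); [None] is the point at infinity, which every
such map fixes. *)
Definition slopes (c b w0 w1 : E) (z : option E) : Prop :=
  if z is Some x then
    (exists r, x = c * i r + b) \/
    (exists r s, x = c * ((w0 + i r) / (w1 + i s)) + b)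
  else True.

(** P and Q have exactly n common points, in the form in which they are counted:
through an injective enumeration by a finite type. *)
Definition share (P Q : option E -> Prop) (n : nat) : Prop :=
  exists (J : finType) (f : J -> option E),
    [/\ injective f, #|J| = n,
        forall z, P z -> Q z -> exists j, z = f j
      & forall j, P (f j) /\ Q (f j)].

Lemma den_neq0 w0 w1 s : indep w0 w1 -> w1 + i s != 0.
Proof.
move=> ind; apply/eqP => e; have [] := ind s 0 1.
  by rewrite rmorph0 rmorph1 mul0r mul1r addr0 addrC.
by move=> _ _ /eqP; rewrite oner_eq0.
Qed.

Lemma indepC w0 w1 : indep w0 w1 -> indep w1 w0.
Proof. by move=> ind r s t e; have [] := ind r t s; first by rewrite addrAC. Qed.

Lemma indep_neq0 w0 w1 : indep w0 w1 -> w0 != 0.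
Proof. by move=> /indepC/(den_neq0 0); rewrite rmorph0 addr0. Qed.

Lemma frac_notin w0 w1 r s a : indep w0 w1 -> (w0 + i r) / (w1 + i s) != i a.
Proof.
move=> ind; apply/eqP => /(canRL (divfK (den_neq0 s ind))) e.
have [] := ind (r - a * s) 1 (- a).
  by apply/eqP; rewrite -[0](subrr (w0 + i r)) {2}e; apply/eqP; ring.
by move=> _ /eqP; rewrite oner_eq0.
Qed.

Lemma frac_inj w0 w1 r s r' s' : indep w0 w1 ->
  (w0 + i r) / (w1 + i s) = (w0 + i r') / (w1 + i s') -> r = r' /\ s = s'.
Proof.
move=> ind e; have /eqP := e.
rewrite eqr_div ?(den_neq0 _ ind) // -subr_eq0 => /eqP {}e.
have [] := ind (r * s' - r' * s) (s' - s) (r - r').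
  by rewrite -[RHS]e; ring.
by move=> _ /subr0_eq-> /subr0_eq->.
Qed.

(** The leading form is r s.  The choice w0 = w, w1 = 1/w makes the conic the
hyperbola r s = 1, along which (w + r) / (1/w + s) simplifies to r w. *)
Lemma share_2q (w : E) (a : F) : indep w w^-1 -> a != 0 -> a + 1 != 0 ->
  share (slopes 1 0 w w^-1) (slopes 1 0 (i a * w) (i (a + 1) * w^-1)) (2 * q).
Proof.
move=> ind a0 a1.
have w0 := indep_neq0 ind.
exists (option (F + {r : F | r != 0})).
exists (fun j => if j is Some j' then
    Some (match j' with inl r => i r | inr r => i (val r) * w end) else None).
have iw r s : r != 0 -> i r * w <> i s.
  move=> r0 e; have [] := ind (- s) r 0; first by rewrite rmorph0 mul0r rmorphN e; ring.
  by move=> _ /eqP; rewrite (negPf r0).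
split.
- move=> [[r|r]|] [[s|s]|] //=; case.
  + by move/fmorph_inj->.
  + by move/esym/iw; rewrite (valP s) => /(_ isT).
  + by move/iw; rewrite (valP r) => /(_ isT).
  + by move/(mulIf w0)/fmorph_inj/val_inj->.
- rewrite card_option card_sum card_sig -addnS mul2n -addnn; congr addn.
  by rewrite (cardD1 0 F) add1n; congr S; apply: eq_card => x; rewrite !inE andbT.
- case=> [x|]; last by exists None.
  move=> /= [[r ->]|[r [s ->]]]; first by exists (Some (inl r)); rewrite mul1r addr0.
  have d2 s2 : i (a + 1) * w^-1 + i s2 != 0.
    apply/eqP => e; have [] := ind s2 0 (a + 1); first by rewrite rmorph0 mul0r addr0 addrC.
    by move=> _ _ /eqP; rewrite (negPf a1).
  have d1 := den_neq0 s ind.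
  rewrite !mul1r !addr0; case=> [[r2]|[r2 [s2]]]; rewrite mul1r addr0.
    by move/eqP; rewrite (negPf (frac_notin _ _ _ ind)).
  move/eqP; rewrite eqr_div // -subr_eq0 => /eqP e.
  have [e0 e1 e2] : [/\ 1 + r * s2 - r2 * s = 0, s2 - a * s = 0 & r * (a + 1) - r2 = 0].
    by apply: ind; rewrite -[RHS]e; field.
  have rs : r * s = 1.
    by apply/esym/subr0_eq; rewrite -[RHS]e0 (subr0_eq e1) -(subr0_eq e2); ring.
  have r0 : r != 0 by apply: contraTneq (oner_neq0 F) => r0; rewrite -rs r0 mul0r eqxx.
  exists (Some (inr (exist _ r r0))); rewrite /=; congr Some.
  apply: (mulIf d1); rewrite divfK //.
  have -> : i r * w * (w^-1 + i s) = i r + i (r * s) * w by field.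
  by rewrite rs rmorph1 mul1r addrC.
- case=> [[r|[r r0]]|] //=; first by split; left; exists r; rewrite mul1r addr0.
  have ri0 : i r != 0 by rewrite fmorph_eq0.
  split; right.
    exists r, r^-1; rewrite mul1r addr0 fmorphV; field.
    rewrite ri0 w0 /= addrC; exact: den_neq0 (indepC ind).
  exists (r * (a + 1)), (a / r); rewrite mul1r addr0 fmorph_div !rmorphM rmorphD rmorph1; field.
  rewrite ri0 w0 /=; apply/eqP => e; have [] := ind (r * (a + 1)) a 0.
    by rewrite -[RHS]e rmorphM rmorphD rmorph1 rmorph0; ring.
  by move=> _ /eqP; rewrite (negPf a0).
Qed.

(** The leading form is the square r^2, and w0 = w, w1 = w^2 give the parabola
s = - r^2, along which (w + r) / (w^2 + s) simplifies to 1 / (w - r). *)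
Lemma share_2q_plus1 (w : E) : indep w (w ^+ 2) ->
  share (slopes 1 0 w (w ^+ 2)) (slopes 1 0 w (w ^+ 2 + w)) (2 * q + 1).
Proof.
move=> ind.
have iw r : w + i r != 0 := den_neq0 r (indepC ind).
have iwN r : w - i r != 0 by rewrite -rmorphN.
exists (option (F + F)).
exists (fun j => if j is Some j' then
    Some (match j' with inl r => i r | inr r => (w + i r)^-1 end) else None).
have iwV r s : (w + i r)^-1 <> i s.
  move=> e; have := divff (iw r); rewrite e => e'.
  have [] := ind (r * s - 1) s 0; first by rewrite rmorphB rmorph1 rmorph0 rmorphM -e'; ring.
  move=> _ s0; case/eqP: (oner_neq0 E); by rewrite -e' s0 rmorph0 mulr0.
split.
- move=> [[r|r]|] [[s|s]|] //=; case.
  + by move/fmorph_inj->.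
  + by move/esym/iwV.
  + by move/iwV.
  + by move/invr_inj/addrI/fmorph_inj->.
- by rewrite card_option card_sum mul2n -addnn addn1.
- case=> [x|]; last by exists None.
  move=> /= [[r ->]|[r [s ->]]]; first by exists (Some (inl r)); rewrite mul1r addr0.
  have d1 := den_neq0 s ind.
  have d2 s2 : w ^+ 2 + w + i s2 != 0.
    apply/eqP => e; have [] := ind s2 1 1; first by rewrite rmorph1 -[RHS]e; ring.
    by move=> _ /eqP; rewrite oner_eq0.
  rewrite !mul1r !addr0; case=> [[r2]|[r2 [s2]]]; rewrite mul1r addr0.
    by move/eqP; rewrite (negPf (frac_notin _ _ _ ind)).
  move/eqP; rewrite eqr_div // -subr_eq0 => /eqP e.
  have [e0 e1 e2] : [/\ r * s2 - r2 * s = 0, s2 + r - s = 0 & 1 + r - r2 = 0].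
    by apply: ind; rewrite -[RHS]e; ring.
  have es : s = - r ^+ 2.
    apply/eqP; rewrite -addr_eq0 -oppr_eq0 -e0 -(subr0_eq e2) -(subr0_eq e1).
    by apply/eqP; ring.
  exists (Some (inr (- r))); rewrite /=; congr Some.
  have -> : w ^+ 2 + i s = (w + i r) * (w - i r) by rewrite es rmorphN rmorphXn /=; ring.
  by rewrite rmorphN invfM mulrA divff ?mul1r.
- case=> [[r|r]|] //=; first by split; left; exists r; rewrite mul1r addr0.
  split; right.
    exists (- r), (- r ^+ 2); rewrite mul1r addr0 rmorphN.
    have -> : w ^+ 2 + i (- r ^+ 2) = (w + i r) * (w - i r).
      by rewrite rmorphN rmorphXn /=; ring.
    by rewrite [_ * (w - _)]mulrC invfM mulrA divff ?mul1r.
  exists (1 - r), (r * (1 - r)); rewrite mul1r addr0.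
  have -> : w ^+ 2 + w + i (r * (1 - r)) = (w + i r) * (w + i (1 - r)).
    by rewrite rmorphM rmorphB rmorph1 /=; ring.
  by rewrite [_ * (w + i (1 - r))]mulrC invfM mulrA divff ?mul1r.
Qed.

(** The leading form G(r,s) = r^2 + g r s + h s^2 is irreducible.  With
w0 = w / G(w,1) and w1 = 1 / G(w,1), which satisfy G(w0,w1) = w1, the conic is
G(r,s) + s = 0.  It passes through the origin, and projection from there
parametrizes its other points by x = r / s in F: s = - 1 / G(x,1), with slope
(x w - h) / (w + x + g).  The origin is the value x = infinity, of slope w. *)
Lemma share_2q_plus2 (w : E) (g h : F) (G := w ^+ 2 + i g * w + i h) :
  indep w (w ^+ 2) ->
  (forall x : F, x ^+ 2 + g * x + h != 0) ->
  share (slopes 1 0 (w / G) G^-1)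
        (slopes 1 0 (- i h / G) ((w + i g) / G)) (2 * q + 2).
Proof.
move=> ind irr.
have ind2 x y z : i x + i y * w + i z * G = 0 -> [/\ x = 0, y = 0 & z = 0].
  move=> e; have [] := ind (x + z * h) (y + z * g) z; first by rewrite -[RHS]e /G; ring.
  by move=> + + z0; rewrite z0 !mul0r !addr0.
have G0 : G != 0.
  apply/eqP => e; have [] := ind2 0 0 1; first by rewrite e !rmorph0; ring.
  by move=> _ _ /eqP; rewrite oner_eq0.
have indG : indep (w / G) G^-1.
  move=> x y z e; have [] := ind2 z y x; last by [].
  by rewrite -[RHS](mulr0 G) -[in RHS]e; field.
have d2 s2 : (w + i g) / G + i s2 != 0.
  apply/eqP => e; have [] := ind2 g 1 s2; last by move=> _ /eqP; rewrite oner_eq0.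
  by rewrite -[RHS](mulr0 G) -[in RHS]e rmorph1; field.
have dw a : w + i a != 0 := den_neq0 a (indepC ind).
have winF a : w <> i a.
  by move=> e; have := dw (- a); rewrite rmorphN e subrr eqxx.
pose z x := (i x * w - i h) / (w + i (x + g)).
have zinF x a : z x <> i a.
  move=> /(canRL (divfK (dw _))) /eqP; rewrite -subr_eq0 => /eqP e.
  have [] := ind (- h - a * (x + g)) (x - a) 0; first by rewrite rmorph0 -[RHS]e; ring.
  move=> /eqP + /subr0_eq xa _; rewrite -oppr_eq0 => e'; case/negP: (irr x).
  by rewrite -(eqP e') xa; apply/eqP; ring.
have z_inj : injective z.
  move=> x y /eqP; rewrite eqr_div // -subr_eq0 => /eqP e.
  have [] := ind (- h * (y + g) + h * (x + g)) ((x * (y + g) - h) - (y * (x + g) - h)) (x - y).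
    by rewrite -[RHS]e; ring.
  by move=> _ _ /subr0_eq.
have zw x : z x <> w.
  move/(canRL (divfK (dw _))) => /eqP; rewrite -subr_eq0 => /eqP e.
  have [] := ind h g 1; first by rewrite rmorph1 -[RHS]oppr0 -[in RHS]e; ring.
  by move=> _ _ /eqP; rewrite oner_eq0.
exists (option (F + option F)).
exists (fun j => if j is Some j' then
    Some (match j' with inl r => i r | inr (Some x) => z x | inr None => w end)
  else None).
split.
- move=> [[r|[r|]]|] [[s|[s|]]|] //=; case.
  + by move/fmorph_inj->.
  + by move/esym/zinF.
  + by move/esym/winF.
  + by move/zinF.
  + by move/z_inj->.
  + by move/zw.
  + by move/winF.
  + by move/esym/zw.
- by rewrite card_option card_sum card_option addnS mul2n -addnn addn2.
- case=> [x|]; last by exists None.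
  move=> /= [[r ->]|[r [s ->]]]; first by exists (Some (inl r)); rewrite mul1r addr0.
  have d1 := den_neq0 s indG.
  rewrite !mul1r !addr0; case=> [[r2]|[r2 [s2]]]; rewrite mul1r addr0.
    by move/eqP; rewrite (negPf (frac_notin _ _ _ indG)).
  move/eqP; rewrite eqr_div // -subr_eq0 => /eqP e.
  have [e0 e1 e2] : [/\ 1 + r * g - (r2 - s * h) = 0, r + s2 = 0 & r * s2 - s * r2 = 0].
    apply: ind2; rewrite -[RHS](mulr0 G) -[in RHS]e /G.
    by field; exact: G0.
  have ec : r ^+ 2 + g * r * s + h * s ^+ 2 + s = 0.
    have er2 : r2 = 1 + r * g + s * h by rewrite (subr0_eq e0) subrK.
    have rs2 : s2 = - r by apply/eqP; rewrite -addr_eq0 addrC e1.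
    by rewrite -[RHS]oppr0 -[in RHS]e2 er2 rs2; ring.
  have [s0|s0] := eqVneq s 0.
    have r0 : r = 0 by apply/eqP; rewrite -sqrf_eq0 -ec s0; apply/eqP; ring.
    exists (Some (inr None)); rewrite r0 s0 rmorph0 /= !addr0; congr Some; field.
    by rewrite G0 oner_eq0.
  exists (Some (inr (Some (r / s)))); rewrite /=; congr Some; rewrite /z.
  have s0i : i s != 0 by rewrite fmorph_eq0.
  apply/eqP; rewrite eqr_div // -subr_eq0; apply/eqP.
  transitivity (i (r ^+ 2 + g * r * s + h * s ^+ 2 + s) / i s).
    by rewrite /G !(fmorph_div, rmorphD) /=; field; rewrite s0i G0.
  by rewrite ec rmorph0 mul0r.
- case=> [[r|[x|]]|] //=; first by split; left; exists r; rewrite mul1r addr0.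
  have irrx := irr x.
  have irri : i (x ^+ 2 + g * x + h) != 0 by rewrite fmorph_eq0.
  have dxg : w + i x + i g != 0 by rewrite -addrA -rmorphD.
  split; right.
    exists (- x / (x ^+ 2 + g * x + h)), (- (x ^+ 2 + g * x + h)^-1).
    set s := - _^-1; rewrite mul1r addr0; apply: (mulIf (den_neq0 s indG)).
    rewrite divfK ?(den_neq0 s indG) // /s.
    rewrite fmorph_div !rmorphN fmorphV /z.
    move: irri G0; rewrite /G !rmorphD rmorphXn rmorphM /= => irri G0'; field.
    by rewrite irri G0' addrA.
  exists (x ^+ 2 / (x ^+ 2 + g * x + h)), (x / (x ^+ 2 + g * x + h)).
  set s := x / _; rewrite mul1r addr0; apply: (mulIf (d2 s)); rewrite divfK // /s.
  rewrite !fmorph_div /z.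
  move: irri G0; rewrite /G !rmorphD rmorphXn rmorphM /= => irri G0'; field.
  by rewrite irri G0' addrA.
split; right.
  exists 0, 0; rewrite rmorph0 !addr0 mul1r; field; by rewrite G0 oner_eq0.
exists 1, 0; rewrite rmorph0 rmorph1 mul1r addr0.
apply: (mulIf (d2 0)); rewrite rmorph0 divfK; last by have := d2 0; rewrite rmorph0.
by rewrite /G; field.
Qed.

(** The projectivity is s' = (a s + j) / d.  It fixes infinity, so finite s are
paired with finite s'; the pairs of an infinite and a finite parameter are
excluded by a != 0 and d != 0, and two infinite ones give no common point
because d != 1 keeps the translation part b out of F.  A fixed s gives no
common point because a != 1: dividing the equation of the two slopes by w + s
leaves one whose w^2-coordinate is 1 - a.  The term t2 (1 - a) in b compensates
the reduction of w^3. *)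
Lemma share_triangular (w : E) (t0 t1 t2 a d j : F) :
  indep (w ^+ 2) w -> w ^+ 3 = i t2 * w ^+ 2 + i t1 * w + i t0 ->
  a != 0 -> a != 1 -> d != 0 -> d != 1 -> a + d != 1 ->
  share (slopes 1 0 (w ^+ 2) w)
        (slopes (i (a + d - 1)) (i (t2 * (1 - a) + j) + i (1 - d) * w) (w ^+ 2) w)
          #|[pred s : F | (d - a) * s != j]|.+1.
Proof.
move=> ind w3 a0 a1 d0 d1 ad1.
pose c := a + d - 1; pose b0 := t2 * (1 - a) + j; pose b1 := 1 - d.
rewrite -/c -/b0 -/b1.
have c0 : c != 0 by rewrite /c subr_eq0.
have ic0 : i c != 0 by rewrite fmorph_eq0.
(* Constant terms of the linear system for r and r2 = c r'; see [key]. *)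
pose P s s2 := b0 * (s + s2) + b1 * s * s2 - (1 - a) * t1.
pose Q s s2 := b0 * s * s2 - (1 - a) * t0.
have dw s : w + i s != 0 := den_neq0 s ind.
(* The cross-multiplied equation of the slopes, in F-coordinates: the middle
   one is the projectivity, the outer two are linear in r and r2. *)
have key r s r2 s2 :
    (w ^+ 2 + i r) * (w + i s2)
      - (i c * w ^+ 2 + i r2 + (i b0 + i b1 * w) * (w + i s2)) * (w + i s)
  = i (r * s2 - r2 * s - Q s s2) + i (d * s2 - (a * s + j)) * w ^+ 2
    + i (r - r2 - P s s2) * w.
  transitivity (i (1 - a) * (w ^+ 3 - (i t2 * w ^+ 2 + i t1 * w + i t0)) +
    (i (r * s2 - r2 * s - Q s s2) + i (d * s2 - (a * s + j)) * w ^+ 2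
     + i (r - r2 - P s s2) * w)).
    by rewrite /P /Q /c /b0 /b1; ring.
  by rewrite w3 subrr mulr0 add0r.
pose m s := (a * s + j) / d.
have fixm s : (m s == s) = ((d - a) * s == j).
  by rewrite /m -(inj_eq (mulIf d0)) divfK // mulrBl subr_eq eq_sym addrC [s * d]mulrC.
pose rr s := (Q s (m s) - s * P s (m s)) / (m s - s).
exists (option {s : F | (d - a) * s != j}).
exists (fun o => if o is Some s then
    Some ((w ^+ 2 + i (rr (val s))) / (w + i (val s))) else None).
split.
- move=> [s|] [s'|] //= [] /(frac_inj ind)[_ es]; congr Some; exact: val_inj.
- by rewrite card_option card_sig.
- case=> [x|]; last by exists None.
  move=> /= [[r ->]|[r [s ->]]]; rewrite mul1r addr0.
    case=> [[r2 e]|[r2 [s2 e]]].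
      have [] := ind (r - c * r2 - b0) 0 (- b1); last first.
        by move=> _ _ /eqP; rewrite oppr_eq0 subr_eq0 eq_sym (negPf d1).
      by rewrite !rmorphB e rmorph0; ring.
    have {}e : (i r - (i b0 + i b1 * w)) * (w + i s2) - i c * (w ^+ 2 + i r2) = 0.
      by rewrite e addrK; field.
    have [] := ind (r * s2 - b0 * s2 - c * r2) (- (b1 + c)) (r - b0 - b1 * s2).
      by rewrite -[RHS]e; ring.
    have bca : b1 + c = a by rewrite /b1 /c; ring.
    by move=> _ /eqP + _; rewrite bca oppr_eq0 (negPf a0).
  case=> [[r2 e]|[r2 [s2 e]]].
    have {}e : w ^+ 2 + i r - (i c * i r2 + (i b0 + i b1 * w)) * (w + i s) = 0.
      by rewrite -e divfK ?subrr.
    have [] := ind (r - (c * r2 + b0) * s) (1 - b1) (- (c * r2 + b0 + b1 * s)).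
      by rewrite -[RHS]e; ring.
    by move=> _ /eqP + _; rewrite /b1 subKr (negPf d0).
  have {}e : (w ^+ 2 + i r) * (w + i s2)
      - (i c * w ^+ 2 + i (c * r2) + (i b0 + i b1 * w) * (w + i s2)) * (w + i s) = 0.
    move/(canRL (divfK (dw s))) : e => ->; field.
    exact: dw.
  have [e0 e2 e1] : [/\ r * s2 - c * r2 * s - Q s s2 = 0, d * s2 - (a * s + j) = 0
      & r - c * r2 - P s s2 = 0] by apply: ind; rewrite -key.
  have ms : s2 = m s.
    by apply: (mulIf d0); rewrite divfK // mulrC (subr0_eq e2).
  have sN : (d - a) * s != j.
    rewrite -fixm -ms; apply: contra_neq a1 => es.
    have /eqP : (w + i s) * ((w ^+ 2 + i r)
      - (i c * w ^+ 2 + i (c * r2) + (i b0 + i b1 * w) * (w + i s))) = 0.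
      by rewrite -[RHS]e es; ring.
    rewrite mulf_eq0 (negPf (dw s)) => /eqP {}e.
    have [] := ind (r - c * r2 - b0 * s) (1 - c - b1) (- (b0 + b1 * s)).
      by rewrite -[RHS]e; ring.
    have bca : 1 - c - b1 = 1 - a by rewrite /b1 /c; ring.
    by move=> _ + _; rewrite bca => /subr0_eq.
  have sms : m s - s != 0 by rewrite subr_eq0 fixm.
  exists (Some (exist _ s sN)); rewrite /= /rr; congr (Some ((_ + i _) / _)).
  apply: (mulIf sms); rewrite divfK // -ms.
  have -> : r * (s2 - s) = Q s s2 - s * P s s2
      + (r * s2 - c * r2 * s - Q s s2) - s * (r - c * r2 - P s s2) by ring.
  by rewrite e0 e1 mulr0 subr0 addr0.
case=> [[s sN]|] //=; split; right; first by exists (rr s), s; rewrite mul1r addr0.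
have sms : m s - s != 0 by rewrite subr_eq0 fixm.
pose r2 := rr s - P s (m s).
exists (r2 / c), (m s).
apply: (mulIf (dw s)); rewrite divfK //; apply: (mulIf (dw (m s))).
apply/eqP; rewrite -subr_eq0; apply/eqP.
transitivity ((w ^+ 2 + i (rr s)) * (w + i (m s)) -
  (i c * w ^+ 2 + i r2 + (i b0 + i b1 * w) * (w + i (m s))) * (w + i s)).
  rewrite fmorph_div; field.
  by rewrite -rmorphB fmorph_eq0 sms dw ic0.
have rE : rr s * (m s - s) = Q s (m s) - s * P s (m s) by rewrite divfK.
rewrite key.
have -> : rr s * m s - r2 * s - Q s (m s) = 0.
  have -> : rr s * m s - r2 * s - Q s (m s)
    = rr s * (m s - s) - (Q s (m s) - s * P s (m s)) by rewrite /r2; ring.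
  by rewrite rE subrr.
have -> : rr s - r2 - P s (m s) = 0 by rewrite /r2; ring.
have -> : d * m s - (a * s + j) = 0 by rewrite /m mulrC divfK // subrr.
by rewrite rmorph0 !mul0r !addr0.
Qed.

(** The projectivity is s' = ((1 - e) s + n) / (1 + s), whose fixed points would
be roots of x^2 + e x - n.  It moves infinity: to s' = 1 - e, which gives the
common point n / t0 of PG(1,F), and from s = -1, which gives - 1/w.  So the
common points are infinity, these two, and one for each of the other q - 1
values of s.  The coefficient n / t0 is the one for which the 1/w-coordinate of
(n / t0) w^2 is n. *)
Lemma share_q_plus2 (w : E) (t0 t1 t2 e n : F) :
  indep w^-1 w -> w ^+ 2 = i t2 * w + i t1 + i t0 / w -> t0 != 0 ->
  e != 1 -> (forall x, x ^+ 2 + e * x - n != 0) ->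
  share (slopes 1 0 w^-1 w) (slopes (i (1 - e)) (i (n / t0) - w^-1) w^-1 w) (q + 2).
Proof.
move=> ind w2 t00 e1 irr.
pose c := 1 - e; pose b0 := n / t0; rewrite -/c -/b0.
have c0 : c != 0 by rewrite subr_eq0 eq_sym.
have ic0 : i c != 0 by rewrite fmorph_eq0.
have nE : n = b0 * t0 by rewrite /b0 divfK.
have dw s : w + i s != 0 := den_neq0 s ind.
have w0 := indep_neq0 (indepC ind).
(* As for a triangular matrix, but in the basis 1, 1/w, w. *)
pose P s s2 := 1 - c + s + s2 - b0 * t1 - b0 * s * s2.
pose R s s2 := 1 - b0 * t2 - b0 * (s + s2).
have key r s r2 s2 :
    (w^-1 + i r) * (w + i s2)
      - (i c * w^-1 + i r2 + (i b0 - w^-1) * (w + i s2)) * (w + i s)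
  = i (P s s2 + r * s2 - r2 * s) + i (s2 * (1 + s) - (c * s + n)) * w^-1
    + i (R s s2 + r - r2) * w.
  transitivity (- i b0 * (w ^+ 2 - (i t2 * w + i t1 + i t0 / w)) +
    (i (P s s2 + r * s2 - r2 * s) + i (s2 * (1 + s) - (c * s + n)) * w^-1
     + i (R s s2 + r - r2) * w)).
    by rewrite /P /R nE; field.
  by rewrite w2 subrr mulr0 add0r.
pose m s := (c * s + n) / (1 + s).
have m_fix s : m s = s -> 1 + s = 0.
  move=> ms; apply/eqP; apply: contraT => s1; case/negP: (irr s).
  have : m s * (1 + s) = c * s + n by rewrite divfK.
  rewrite ms => /eqP; rewrite -subr_eq0 /c => /eqP es.
  by rewrite -[X in _ == X]es; apply/eqP; ring.
pose rr s := (P s (m s) - s * R s (m s)) / (s - m s).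
exists (option (option (option {s : F | 1 + s != 0}))).
exists (fun o => if o is Some o' then Some (match o' with
  | None => i b0 | Some None => - w^-1
  | Some (Some s) => (w^-1 + i (rr (val s))) / (w + i (val s)) end) else None).
have wVF s : - w^-1 != i s.
  apply/eqP => ew; have [] := ind s 1 0; first by rewrite -ew rmorph0 rmorph1; ring.
  by move=> _ /eqP; rewrite oner_eq0.
have wVfrac : - w^-1 = (w^-1 + i (- 1)) / (w + i (-1)).
  apply: (mulIf (dw (-1))); rewrite divfK // rmorphN rmorph1; field.
  exact: w0.
split.
- move=> [[[[s sN]|]|]|] [[[[s' sN']|]|]|] //= [].
  + by move=> /(frac_inj ind)[_ es]; do 3!congr Some; exact: val_inj.
  + rewrite wVfrac => /(frac_inj ind)[_ es]; by case/negP: (sN); rewrite es subrr.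
  + by move/eqP; rewrite (negPf (frac_notin _ _ _ ind)).
  + rewrite wVfrac => /(frac_inj ind)[_ es]; by case/negP: (sN'); rewrite -es subrr.
  + by move/eqP; rewrite (negPf (wVF _)).
  + by move/esym/eqP; rewrite (negPf (frac_notin _ _ _ ind)).
  + by move/esym/eqP; rewrite (negPf (wVF _)).
- rewrite !card_option card_sig !addnS addn0; do 2!congr S.
  rewrite (cardD1 (-1) F) add1n; congr S; apply: eq_card => x; rewrite !inE andbT.
  by rewrite addrC addr_eq0.
- case=> [x|]; last by exists None.
  move=> /= [[r ->]|[r [s ->]]]; rewrite mul1r addr0.
    case=> [[r2 ex]|[r2 [s2 ex]]].
      have [] := ind (r - c * r2 - b0) 1 0; last by move=> _ /eqP; rewrite oner_eq0.
      by rewrite !rmorphB ex rmorph0 rmorph1; ring.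
    have {}ex : (i r - (i b0 - w^-1)) * (w + i s2) - i c * (w^-1 + i r2) = 0.
      by rewrite ex addrK; field; rewrite w0 dw.
    have [] := ind ((r - b0) * s2 + 1 - c * r2) (s2 - c) (r - b0).
      by rewrite -[RHS]ex; field.
    by move=> _ _ /subr0_eq ->; exists (Some None).
  case=> [[r2 ex]|[r2 [s2 ex]]].
    have {}ex : w^-1 + i r - (i c * i r2 + (i b0 - w^-1)) * (w + i s) = 0.
      by rewrite -ex divfK ?subrr.
    have [] := ind (r - (c * r2 + b0) * s + 1) (1 + s) (- (c * r2 + b0)).
      by rewrite -[RHS]ex; field.
    move=> er es eb; exists (Some (Some None)); rewrite /= wVfrac.
    have -> : s = -1 by apply/eqP; rewrite -addr_eq0 addrC es.
    move/eqP: eb; rewrite oppr_eq0 => /eqP eb.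
    by move/eqP: er; rewrite eb mul0r subr0 addr_eq0 => /eqP->.
  have {}ex : (w^-1 + i r) * (w + i s2)
      - (i c * w^-1 + i (c * r2) + (i b0 - w^-1) * (w + i s2)) * (w + i s) = 0.
    move/(canRL (divfK (dw s))) : ex => ->; field.
    by rewrite w0 dw.
  have [e0 e2 e3] : [/\ P s s2 + r * s2 - c * r2 * s = 0, s2 * (1 + s) - (c * s + n) = 0
      & R s s2 + r - c * r2 = 0] by apply: ind; rewrite -key.
  have [s1|s1] := eqVneq (1 + s) 0.
    move/eqP: e2; rewrite s1 mulr0 sub0r oppr_eq0.
    have -> : s = -1 by apply/eqP; rewrite -addr_eq0 addrC s1.
    move=> /eqP e2; case/negP: (irr (-1)); rewrite -[X in _ == X]oppr0 -e2 /c.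
    by apply/eqP; ring.
  have ms : s2 = m s by apply: (mulIf s1); rewrite divfK // (subr0_eq e2).
  have sms : s - m s != 0.
    by rewrite subr_eq0 eq_sym; apply: contra_neq s1; exact: m_fix.
  exists (Some (Some (Some (exist _ s s1)))); rewrite /= /rr; congr (Some ((_ + i _) / _)).
  apply: (mulIf sms); rewrite divfK // -ms.
  have -> : r * (s - s2) = P s s2 - s * R s s2
      - (P s s2 + r * s2 - c * r2 * s) + s * (R s s2 + r - c * r2) by ring.
  by rewrite e0 e3 mulr0 subr0 addr0.
case=> [[[[s s1]|]|]|] //=.
- split; right; first by exists (rr s), s; rewrite mul1r addr0.
  have sms : s - m s != 0.
    by rewrite subr_eq0 eq_sym; apply: contra_neq s1; exact: m_fix.
  have rE : rr s * (s - m s) = P s (m s) - s * R s (m s) by rewrite divfK.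
  have mE : m s * (1 + s) = c * s + n by rewrite divfK.
  exists ((R s (m s) + rr s) / c), (m s).
  move: (rr s) (m s) rE mE => r s2 rE mE {sms}.
  apply: (mulIf (dw s)); rewrite divfK //; apply: (mulIf (dw s2)).
  apply/eqP; rewrite -subr_eq0; apply/eqP.
  set r2 := R s s2 + r.
  transitivity ((w^-1 + i r) * (w + i s2) -
    (i c * w^-1 + i r2 + (i b0 - w^-1) * (w + i s2)) * (w + i s)).
    rewrite fmorph_div; field.
    by rewrite ic0 w0 !dw.
  rewrite key mE subrr rmorph0 mul0r addr0.
  have -> : R s s2 + r - r2 = 0 by rewrite /r2 subrr.
  have -> : P s s2 + r * s2 - r2 * s = P s s2 - s * R s s2 - r * (s - s2) by rewrite /r2; ring.
  by rewrite rE subrr rmorph0 mul0r addr0.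
- split; first by right; exists (-1), (-1); rewrite mul1r addr0.
  by left; exists (- b0 / c); rewrite fmorph_div rmorphN; field; rewrite ic0 w0.
split; first by left; exists b0; rewrite mul1r addr0.
right; exists (c^-1), c; rewrite fmorphV; field.
by rewrite ic0 w0 dw.
Qed.

(** The case of the field with 27 elements, generated by w with w^3 = w - 1; the
four common points are infinity, 0, w - 1 and w^2 - 1.  For two slopes with
finite parameters, eliminating r and s' leaves a cubic in r' and s, and its only
zero among the nine candidates is r' = -1, s = 1. *)
Lemma share_4 (w : E) : indep (w ^+ 2) w -> w ^+ 3 = w - 1 ->
  (forall x : F, [|| x == 0, x == 1 | x == -1]) -> 1 + 1 + 1 = 0 :> F ->
  share (slopes 1 0 (w ^+ 2) w) (slopes (w - 1) 0 (w ^+ 2) w) 4.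
Proof.
move=> ind w3 F3 char3.
have char3E : 1 + 1 + 1 = 0 :> E by rewrite -[1](rmorph1 i) -!rmorphD char3 rmorph0.
have dw s : w + i s != 0 := den_neq0 s ind.
have wF a : w != i a.
  by rewrite -subr_eq0 -rmorphN dw.
have w2F a b : w ^+ 2 != i a * w + i b.
  rewrite -subr_eq0; apply/eqP => e; have [] := ind (- b) 1 (- a).
    by rewrite -[RHS]e rmorph1; ring.
  by move=> _ /eqP; rewrite oner_eq0.
pose pts := [:: None; Some 0; Some (w - 1); Some (w ^+ 2 - 1)].
exists 'I_4, (fun j : 'I_4 => nth None pts j).
have pts_uniq : uniq pts.
  rewrite /= !inE !negb_or !andbT /= -andbA; apply/and3P; split; apply/eqP => -[] /esym/eqP.
  - by rewrite subr_eq0 -(rmorph1 i) (negPf (wF 1)).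
  - by rewrite subr_eq0; have := w2F 0 1; rewrite rmorph0 rmorph1 mul0r add0r => /negPf->.
  by rewrite (inj_eq (addIr _)); have := w2F 1 0; rewrite rmorph0 rmorph1 mul1r addr0 => /negPf->.
split.
- move=> j k /eqP; rewrite nth_uniq // => /eqP; exact: val_inj.
- exact: card_ord.
- have ptsP z : z \in pts -> exists j : 'I_4, z = nth None pts j.
    move=> zp; have lt4 : (index z pts < 4)%N by rewrite -[4%N]/(size pts) index_mem.
    by exists (Ordinal lt4); rewrite /= nth_index.
  move=> z Az Bz; apply: ptsP; move: z Az Bz.
  case=> [x|] //=; case=> [[r ->]|[r [s ->]]]; rewrite mul1r addr0.
    case=> [[r2 e]|[r2 [s2 e]]]; move: e; rewrite addr0 => e.
      have [] := ind (r + r2) 0 (- r2); first by rewrite rmorph0 rmorphD e; ring.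
      move=> e1 _ /eqP; rewrite oppr_eq0 => /eqP e2; move: e1; rewrite e2 addr0 => ->.
      by rewrite rmorph0 !inE eqxx orbT.
    have {}e : i r * (w + i s2) - (w - 1) * (w ^+ 2 + i r2) - (w - 1 - w ^+ 3) = 0.
      by rewrite w3 e; field; exact: dw.
    have [] := ind (r * s2 + r2 + 1) 1 (r - r2 - 1); first by rewrite -[RHS]e; ring.
    by move=> _ /eqP; rewrite oner_eq0.
  case=> [[r2 e]|[r2 [s2 e]]]; move: e; rewrite addr0 => e.
    have e' : w ^+ 2 + i r - (w - 1) * i r2 * (w + i s) = 0.
      by rewrite -e divfK ?subrr.
    have [] := ind (r + r2 * s) (1 - r2) (- (r2 * (s - 1))); first by rewrite -[RHS]e'; ring.
    move=> _ /subr0_eq r21 _; rewrite e -r21 rmorph1 mulr1.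
    by rewrite !inE eqxx !orbT.
  have e' : (w ^+ 2 + i r) * (w + i s2) - (w - 1) * (w ^+ 2 + i r2) * (w + i s)
      - (1 + 1 - i s - w) * (w ^+ 3 - (w - 1)) = 0.
    rewrite w3 subrr mulr0 subr0; move/(canRL (divfK (dw s))) : e => ->; field; exact: dw.
  have [e0 e2 e1] : [/\ r * s2 - 1 - (1 - s - r2 * s) = 0, s2 - (r2 + 1 - s) = 0
      & r + 1 - (r2 * s - r2 - 1 - 1 + s) = 0].
    apply: ind; rewrite -[RHS]e'; ring.
  pose f r2 s : F := (r2 * s - r2 + s) * (r2 + 1 - s) + s + r2 * s - 1 - 1.
  have f0 : f r2 s = 0.
    rewrite -[RHS]e0 (subr0_eq e2) (_ : r = r2 * s - r2 + s); first by rewrite /f; ring.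
    by apply/eqP; rewrite -subr_eq0 -[X in _ == X]e1 -[X in _ == X]subr0 -char3; apply/eqP; ring.
  (* Outside (-1, 1) the value of f is 1 or -1, plus a multiple of 3. *)
  have f3 k m : f r2 s = k + (1 + 1 + 1) * m -> k != 0 -> False.
    by rewrite f0 char3 mul0r addr0 => <-; rewrite eqxx.
  have N1 : -1 != 0 :> F by rewrite oppr_eq0 oner_eq0.
  have [r2E sE] : r2 = -1 /\ s = 1.
    case/or3P: (F3 r2) => /eqP r2E; case/or3P: (F3 s) => /eqP sE;
      rewrite r2E sE in f3 * => //; exfalso.
    - by apply: (f3 1 (-1)); rewrite ?oner_eq0 // /f; ring.
    - by apply: (f3 (-1) 0); rewrite // /f; ring.
    - by apply: (f3 1 (- 1 - 1)); rewrite ?oner_eq0 // /f; ring.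
    - by apply: (f3 (-1) (-1)); rewrite // /f; ring.
    - by apply: (f3 1 0); rewrite ?oner_eq0 // /f; ring.
    - by apply: (f3 (-1) (- 1 - 1 - 1 - 1)); rewrite // /f; ring.
    - by apply: (f3 1 (-1)); rewrite ?oner_eq0 // /f; ring.
    - by apply: (f3 (-1) 0); rewrite // /f; ring.
  have {}e1 : r = 1.
    move: e1; rewrite r2E sE; set v := _ - _ => v0.
    have -> : r = 1 + v - (1 + 1 + 1) by rewrite /v; ring.
    by rewrite v0 char3 addr0 subr0.
  have {}e2 : s2 = -1.
    by apply/eqP; rewrite -subr_eq0 -[X in _ == X]e2 r2E sE; apply/eqP; ring.
  have -> : (w ^+ 2 + i r) / (w + i s) = w ^+ 2 - 1.
    apply: (mulIf (dw s)); rewrite divfK // e1 sE rmorph1.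
    transitivity (w ^+ 2 + 1 + (w ^+ 3 - (w - 1)) - (1 + 1 + 1)); last by ring.
    by rewrite w3 subrr char3E addr0 subr0.
  by rewrite !inE eqxx !orbT.
move=> [[|[|[|[|//]]]] lt4] /=; split=> //.
- by left; exists 0; rewrite rmorph0 mulr0 addr0.
- by left; exists 0; rewrite rmorph0 mulr0 addr0.
- right; exists (-1), 1; rewrite mul1r addr0; apply: (mulIf (dw 1)); rewrite divfK //.
  by rewrite rmorphN rmorph1; ring.
- by left; exists 1; rewrite rmorph1 mulr1 addr0.
- right; exists 1, 1; rewrite mul1r addr0; apply: (mulIf (dw 1)); rewrite divfK // rmorph1.
  transitivity (w ^+ 2 + 1 + (w ^+ 3 - (w - 1)) - (1 + 1 + 1)); first by ring.
  by rewrite w3 subrr char3E addr0 subr0.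
right; exists (-1), (-1); rewrite addr0 rmorphN rmorph1 mulrC divfK //.
by have := dw (-1); rewrite rmorphN rmorph1.
Qed.

End Slopes.

(** * Planes and their linear sets *)

Section Minors.

Local Open Scope ring_scope.

Lemma minor0_ratio (K : fieldType) (x y x' y' : K) :
  y' != 0 -> x * y' - x' * y = 0 -> x = y / y' * x'.
Proof.
move=> y0 /subr0_eq e; apply: (mulIf y0); rewrite e mulrAC divfK //.
exact: mulrC.
Qed.

Lemma minors0_proportional (K : fieldType) (r s t r' s' t' : K) :
  [/\ r * s' - r' * s = 0, t * s' - t' * s = 0 & r * t' - r' * t = 0] ->
  [|| r' != 0, s' != 0 | t' != 0] ->
  exists a, [/\ r = a * r', s = a * s' & t = a * t'].
Proof.
move=> [m1 m2 m3] /or3P[] n0.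
- exists (r / r'); rewrite divfK //; split=> //; apply: minor0_ratio => //.
    by rewrite -[RHS]oppr0 -m1; ring.
  by rewrite -[RHS]oppr0 -m3; ring.
- by exists (s / s'); rewrite divfK //; split=> //; apply: minor0_ratio.
exists (t / t'); rewrite divfK //; split=> //; apply: minor0_ratio => //.
by rewrite -[RHS]oppr0 -m2; ring.
Qed.

End Minors.

Section Points.

Local Open Scope ring_scope.

Variables (F : finFieldType) (L : fieldExtType F).
Local Notation E := (finvect_type L).
Local Notation q := #|F|.

Definition on (z : option E) (v : E * E) : bool :=
  if z is Some x then v.1 == x * v.2 else v.2 == 0.

Definition slope (v : E * E) : option E :=
  if v.2 == 0 then None else Some (v.1 / v.2).

Lemma onP (z : option E) (v : E * E) : v != 0 -> on z v = (slope v == z).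
Proof.
case: v => v1 v2 v0; rewrite /on /slope /=.
have [v20|v2N0] := eqVneq v2 0.
  case: z => [x|//]; rewrite v20 mulr0; apply/negbTE.
  by apply: contraNneq v0 => ->; rewrite v20.
case: z => [x|]; last exact: negbTE.
rewrite -[RHS]/(v1 / v2 == x); apply/eqP/eqP => [->|<-]; first by rewrite mulfK.
by rewrite divfK.
Qed.

Lemma slope_eqP (u v : E * E) : u != 0 -> v != 0 ->
  reflect (exists2 k : E, k != 0 & u = (k * v.1, k * v.2)) (slope u == slope v).
Proof.
case: u v => [u1 u2] [v1 v2] u0 v0; apply: (iffP idP) => /= [|[k k0 [-> ->]]].
  rewrite -onP // /on /slope /=; case: eqVneq => [v20|v2N0] /eqP u12.
    have v1N0 : v1 != 0 by apply: contraNneq v0 => ->; rewrite v20.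
    have u1N0 : u1 != 0 by apply: contraNneq u0 => ->; rewrite u12.
    by exists (u1 / v1); rewrite ?mulf_neq0 ?invr_eq0 // divfK // v20 mulr0 u12.
  have u2N0 : u2 != 0 by apply: contraNneq u0 => u20; rewrite u12 u20 mulr0.
  exists (u2 / v2); rewrite ?mulf_neq0 ?invr_eq0 // divfK // u12.
  by congr pair; rewrite mulrC mulrA mulrAC.
rewrite /slope /= mulf_eq0 (negPf k0) /=; case: ifP => // _.
by rewrite -mulf_div divff // mul1r.
Qed.

Definition dir (z : option E) : L2 L := if z is Some x then (x, 1) else (1, 0).

Lemma dir_neq0 z : dir z != 0.
Proof.
case: z => [x|]; rewrite -pair_eqE /pair_eq /= negb_and oner_eq0 ?orbT //.
Qed.

Fact pt_subproof z : \dim <[dir z]>%VS == 1%N.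
Proof. by rewrite dim_vline dir_neq0. Qed.

Definition pt (z : option E) : PG1 L := exist _ <[dir z]>%VS (pt_subproof z).

Lemma mem_pt z (v : E * E) : ((v : L2 L) \in val (pt z)) = on z v.
Proof.
apply/vlineP/idP => [[k ->]|]; case: z => [x|]; rewrite /on /=.
- by rewrite /GRing.scale /= mulr1 mulrC.
- by rewrite /GRing.scale /= mulr0.
- case: v => v1 v2 /= /eqP ->; exists v2; congr pair.
    by rewrite /GRing.scale /= mulrC.
  by rewrite /GRing.scale /= mulr1.
case: v => v1 v2 /= /eqP ->; exists v1; congr pair.
  by rewrite /GRing.scale /= mulr1.
by rewrite /GRing.scale /= mulr0.
Qed.

Lemma pt_bij : bijective pt.
Proof.
have pt_inj : injective pt.
  move=> y z eq_yz; have := mem_pt y (dir y); rewrite eq_yz mem_pt.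
  rewrite (onP _ (dir_neq0 y)) (onP _ (dir_neq0 y)).
  have slopeK x : slope (dir x) = x.
    by case: x => [x|]; rewrite /slope /= ?eqxx // oner_eq0 divr1.
  by rewrite slopeK eqxx => /eqP.
apply: inj_card_bij (pt_inj) _.
rewrite -(card_codom pt_inj); apply: subset_leq_card.
apply/subsetP => -[X dX] _; apply/codomP.
have X0 : X != 0%VS by rewrite -dimv_eq0 (eqP dX).
pose v := vpick X; have v0 : v != 0 by rewrite vpick0.
exists (slope v); apply: val_inj => /=; apply/esym/eqP.
rewrite eqEdim dim_vline dir_neq0 (eqP dX) leqnn andbT -memvE.
have : on (slope v) v by rewrite onP.
rewrite -mem_pt /= => /vlineP[k vk].
have k0 : k != 0 by apply: contraNneq v0 => k0; rewrite vk k0 scale0r.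
have -> : dir (slope v) = k^-1 *: v by rewrite [in RHS]vk scalerA mulVf // scale1r.
by rewrite memvZ // memv_pick.
Qed.

Lemma linear_setP (pi : {vspace V6 L}) z :
  reflect (exists v : E * E, [/\ v \in pi, v != 0 & on z v]) (pt z \in linear_set pi).
Proof.
rewrite inE /meets; apply: (iffP idP) => [XN0|[v [v_pi v0 onv]]].
  exists (vpick (spread_elt (pt z) :&: pi)%VS).
  have /[!memv_cap] /andP[vX v_pi] := memv_pick (spread_elt (pt z) :&: pi)%VS.
  by rewrite vpick0 XN0 v_pi -mem_pt -mem_spread_elt vX.
apply: contraNneq v0 => XN0; rewrite -memv0 -XN0 memv_cap v_pi andbT.
by rewrite mem_spread_elt mem_pt.
Qed.

(** Each point of PG(1,L) meets pi in at most one projective point over F, stated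
for vectors. *)
Definition scattered (pi : {vspace V6 L}) : Prop :=
  forall (u v : E * E) (k : E), u \in pi -> v \in pi -> v != 0 ->
  u = (k * v.1, k * v.2) -> exists a : F, k = a%:A.

(** The slope maps the q^3 - 1 nonzero vectors of pi onto its linear set, and the
fibre of v consists of the F-multiples of v. *)
Lemma card_scattered (pi : {vspace V6 L}) :
  \dim pi = 3%N -> scattered pi -> #|linear_set pi| = (q ^ 2 + q + 1)%N.
Proof.
move=> dim_pi sc_pi.
pose T : finType := finvect_type (V6 L).
pose f : T -> option E := slope.
pose S := [set v : T | (v \in pi) && (v != 0)].
have q1 : (1 < q)%N by exact: finNzRing_gt1.
have inS v : (v \in S) = (v \in pi) && (v != 0) by rewrite inE.
have cS : #|S| = (q ^ 3 - 1)%N.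
  rewrite -dim_pi -(card_vspace (pi : {vspace finvect_type (V6 L)})).
  have -> : S = [set v : T | v \in pi] :\ 0 by apply/setP=> v; rewrite !inE andbC.
  by rewrite cardsDS ?sub1set ?inE ?mem0v // cards1 cardsE.
have imS : f @: S = [set z | pt z \in linear_set pi].
  apply/setP=> z; rewrite [RHS]inE; apply/imsetP/linear_setP.
    move=> [v]; rewrite inS => /andP[v_pi v0] ->; exists v; split=> //.
    by rewrite onP.
  by move=> [v [v_pi v0]]; rewrite onP // => /eqP <-; exists v; rewrite // inS v_pi.
have cim : #|f @: S| = #|linear_set pi|.
  have -> : f @: S = pt @^-1: linear_set pi by rewrite imS; apply/setP=> z; rewrite !inE.
  by rewrite on_card_preimset //; exact: onW_bij pt_bij.
have fib z : z \in f @: S -> (\sum_(v in S | f v == z) 1 = q - 1)%N.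
  case/imsetP=> v; rewrite inS => /andP[v_pi v0] ->.
  transitivity #|(fun a : F => a *: (v : T)) @: [set a | a != 0]|; last first.
    rewrite card_imset; last by move=> a b /eqP; rewrite -subr_eq0 -scalerBl scaler_eq0
      (negPf v0) orbF subr_eq0 => /eqP.
    by rewrite cardsE; have := cardC1 (0 : F); rewrite subn1 => <-.
  rewrite sum1dep_card; apply: eq_card => u; rewrite inE inS.
  apply/idP/imsetP => [/andP[/andP[u_pi u0] suv]|[a /[!inE] a0 ->]].
    rewrite /f in suv; have [k _ uk] := slope_eqP u0 v0 suv.
    have [a ka] := sc_pi u v k u_pi v_pi v0 uk.
    exists a; last by rewrite uk ka; congr pair; exact: mulr_algl.
    rewrite inE; apply: contraNneq u0 => a0; rewrite uk ka a0 scale0r.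
    by rewrite !mul0r.
  rewrite memvZ // scaler_eq0 negb_or a0 v0 /=.
  apply/(slope_eqP (u := a *: v)); rewrite ?scaler_eq0 ?negb_or ?a0 //.
  exists (in_alg E a); first by rewrite fmorph_eq0.
  by congr pair; rewrite /= mulr_algl.
apply/eqP; rewrite -(eqn_pmul2r (_ : 0 < q - 1)%N) ?subn_gt0 // -cim.
have := partition_big_imset f S (fun=> 1%N) : (\sum_(v in S) 1 = _)%N.
rewrite sum1_card cS (eq_bigr _ fib) sum_nat_const => <-.
have := subn_exp q 1 3; rewrite exp1n => ->.
by rewrite !big_ord_recr big_ord0 /= !exp1n !muln1 mulnC add0n.
Qed.

Lemma spread_elt_inj : injective (@spread_elt F L).
Proof.
move=> X Y eqXY; apply/val_inj/vspaceP => v.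
by have := mem_spread_elt X v; rewrite eqXY mem_spread_elt.
Qed.

(** The linear set of a spread element is a single point. *)
Lemma scattered_notin_spread (pi : {vspace V6 L}) :
  \dim pi = 3%N -> scattered pi -> pi \notin desarguesian_spread L.
Proof.
move=> dim_pi sc_pi; apply/negP => /imsetP[X _ piX].
have [pt' ptK pt'K] := pt_bij.
have sub1 : linear_set pi \subset [set X].
  apply/subsetP => Y; rewrite -(pt'K Y) inE => /linear_setP[v [v_pi v0]].
  move: v_pi; rewrite piX mem_spread_elt -(pt'K X) mem_pt !onP //.
  by move=> /eqP <- /eqP <-.
have := subset_leq_card sub1; rewrite cards1 card_scattered // addn1 ltnS leqn0.
by rewrite addn_eq0 (cardD1 0 F) andbF.
Qed.

(** Distinct points have distinct spread elements, so the spread elements that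
meet pi are as many as the points of its linear set. *)
Lemma scattered_max (pi : {vspace V6 L}) :
  \dim pi = 3%N -> scattered pi -> max_scattered_linear_set (linear_set pi).
Proof.
move=> dim_pi sc_pi; exists pi; split=> //; first exact: scattered_notin_spread.
rewrite -(card_scattered dim_pi sc_pi) -(card_imset _ spread_elt_inj); apply: eq_card => U.
rewrite inE; apply/andP/imsetP => [[/imsetP[X _ ->] meetsX]|[X Xpi ->]].
  by exists X; rewrite // inE.
by split; [exact: imset_f | rewrite inE in Xpi].
Qed.

Lemma card_common (pi1 pi2 : {vspace V6 L}) (J : finType) (f : J -> option E) :
  injective f ->
  (forall z, pt z \in linear_set pi1 -> pt z \in linear_set pi2 -> exists j, z = f j) ->
  (forall j, pt (f j) \in linear_set pi1 /\ pt (f j) \in linear_set pi2) ->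
  #|linear_set pi1 :&: linear_set pi2| = #|J|.
Proof.
move=> f_inj sub sup; have ptf_inj := inj_comp (bij_inj pt_bij) f_inj.
rewrite -(card_imset _ ptf_inj); apply: eq_card => X.
have [pt' _ pt'K] := pt_bij; rewrite inE -(pt'K X).
apply/andP/imsetP => [[X1 X2]|[j _ ->]]; last exact: sup.
by have [j ->] := sub _ X1 X2; exists j.
Qed.

(** The embedding of F in L, sealed so that it stays an abstract ring morphism
under simplification; [embE] is the only access to its value. *)
Fact emb_key : {i : {rmorphism F -> E} | forall a, i a = a%:A}.
Proof. by exists (in_alg E). Qed.
Definition emb : {rmorphism F -> E} := sval emb_key.
Lemma embE a : emb a = a%:A.
Proof. exact: (svalP emb_key). Qed.
Local Notation i := emb.

(** The image of the plane spanned by (1,0), (0,1), (w0,w1) under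
(x,y) |-> (c x + b y, y), which acts on slopes as z |-> c z + b. *)
Definition plane (c b w0 w1 : E) : {vspace V6 L} :=
  <<[:: ((c, 0) : V6 L); (b, 1); (c * w0 + b * w1, w1)]%R>>%VS.

Definition planevec (c b w0 w1 : E) (r s t : F) : E * E :=
  (c * (i r + i t * w0) + b * (i s + i t * w1), i s + i t * w1).

Lemma scale_pairE (a : F) (x y : E) : a *: ((x, y) : V6 L) = (i a * x, i a * y).
Proof. by congr pair; rewrite /= embE mulr_algl. Qed.

Lemma add_pairE (x y x' y' : E) :
  ((x, y) : V6 L) + ((x', y') : V6 L) = (x + x', y + y').
Proof. by []. Qed.

Lemma planevecE c b w0 w1 r s t : planevec c b w0 w1 r s t =
  (r *: ((c, 0) : V6 L) + s *: ((b, 1) : V6 L) + t *: ((c * w0 + b * w1, w1) : V6 L)).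
Proof.
rewrite !scale_pairE !add_pairE /planevec; congr pair; rewrite /=; ring.
Qed.

Lemma planeP c b w0 w1 (v : E * E) :
  reflect (exists r s t, v = planevec c b w0 w1 r s t) (v \in plane c b w0 w1).
Proof.
rewrite /plane !span_cons span_nil addv0.
apply: (iffP memv_addP) => [|[r [s [t ->]]]].
  move=> [_ /vlineP[r ->] [_ /memv_addP[_ /vlineP[s ->] [_ /vlineP[t ->] ->]] ->]].
  by exists r, s, t; rewrite planevecE addrA.
rewrite planevecE -addrA.
exists (r *: ((c, 0) : V6 L)); first by rewrite memvZ ?memv_line.
eexists; last by [].
by rewrite memv_add // memvZ // memv_line.
Qed.

Section Plane.
Variables (c b w0 w1 : E).
Hypotheses (c0 : c != 0) (ind : indep emb w0 w1).

Lemma planevec_eq0 r s t :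
  planevec c b w0 w1 r s t = 0 -> [/\ r = 0, s = 0 & t = 0].
Proof.
move=> /pair_equal_spec[e1 e2].
rewrite e2 mulr0 addr0 in e1.
have [s0 _ t0] : [/\ s = 0, 0 = 0 :> F & t = 0].
  by apply: ind; rewrite rmorph0 mul0r addr0.
move/eqP: e1; rewrite mulf_eq0 (negPf c0) /= t0 rmorph0 mul0r addr0 fmorph_eq0.
by move/eqP.
Qed.

Lemma dim_plane : \dim (plane c b w0 w1) = 3%N.
Proof.
apply/eqP.
rewrite -[_ == _]/(free (in_tuple [:: ((c, 0) : V6 L); (b, 1); (c * w0 + b * w1, w1)])).
apply/freeP => k; rewrite !big_ord_recl big_ord0 addr0 /= addrA -planevecE.
case/planevec_eq0=> k0 k1 k2 [[|[|[|//]]] lt3].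
- by rewrite -[RHS]k0; congr k; apply: val_inj.
- by rewrite -[RHS]k1; congr k; apply: val_inj.
- by rewrite -[RHS]k2; congr k; apply: val_inj.
Qed.

(** Cross-multiplying two L-proportional vectors cancels the w0 w1 terms and
leaves a relation between 1, w0, w1 whose coefficients are the 2 x 2 minors of
the coordinates; so the coordinates are proportional over F. *)
Lemma scattered_plane : scattered (plane c b w0 w1).
Proof.
move=> _ _ k /planeP[r [s [t ->]]] /planeP[r' [s' [t' ->]]] v0 [e1 e2].
have {}e1 : i r + i t * w0 = k * (i r' + i t' * w0).
  apply: (mulfI c0); apply: (addIr (b * (i s + i t * w1))).
  by rewrite e1 e2; ring.
have [m1 m2 m3] : [/\ r * s' - r' * s = 0, t * s' - t' * s = 0 & r * t' - r' * t = 0].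
  apply: ind; transitivity ((i r + i t * w0) * (i s' + i t' * w1)
     - (i r' + i t' * w0) * (i s + i t * w1)); first by ring.
  by rewrite e1 e2; ring.
have {v0} n0 : [|| r' != 0, s' != 0 | t' != 0].
  apply: contraNT v0; rewrite !negb_or !negbK => /and3P[/eqP-> /eqP-> /eqP->].
  by rewrite /planevec !rmorph0 !mul0r !addr0 !mulr0 addr0.
have [a [ra sa ta]] := minors0_proportional (And3 m1 m2 m3) n0.
exists a; rewrite -embE; apply/eqP; apply: contraT => ka.
have ka0 : k - i a != 0 by rewrite subr_eq0.
have [s0 _ t0] : [/\ s' = 0, 0 = 0 :> F & t' = 0].
  apply: ind; apply: (mulfI ka0); rewrite mulr0 rmorph0 mul0r addr0 mulrBl -e2 sa ta.
  by ring.
have [r0 _ _] : [/\ r' = 0, t' = 0 & 0 = 0 :> F].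
  apply: ind; apply: (mulfI ka0); rewrite mulr0 rmorph0 mul0r addr0 mulrBl -e1 ra ta.
  by ring.
by rewrite r0 s0 t0 !eqxx in n0.
Qed.

End Plane.

End Points.

(** * From slopes back to linear sets *)

Section PlaneSlopes.

Local Open Scope ring_scope.

Variables (F : finFieldType) (L : fieldExtType F).
Local Notation E := (finvect_type L).
Local Notation q := #|F|.
Local Notation i := (@emb F L).

Lemma plane_slopesP (c b w0 w1 : E) (z : option E) : c != 0 -> indep i w0 w1 ->
  pt z \in linear_set (plane c b w0 w1) <-> slopes i c b w0 w1 z.
Proof.
move=> c0 ind; split=> [/linear_setP[_ [/planeP[r [s [t ->]]] v0]]|].
  case: z => [x|] //; rewrite /on /planevec /= => /eqP e.
  have [t0|t0] := eqVneq t 0.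
    left; exists (r / s); rewrite t0 in e v0.
    have s0 : i s != 0.
      apply: contraNneq v0 => s0; apply/eqP; move: e.
      by rewrite /planevec s0 !rmorph0 !mul0r !addr0 !mulr0 addr0 => ->.
    apply: (mulIf s0); move: e; rewrite rmorph0 !mul0r !addr0 => <-.
    by rewrite fmorph_div; field.
  right; exists (r / t), (s / t); have it0 : i t != 0 by rewrite fmorph_eq0.
  have ds := den_neq0 (s / t) ind.
  apply: (mulIf ds); apply: (mulIf it0).
  have -> : x * (w1 + i (s / t)) * i t = x * (i s + i t * w1) by rewrite fmorph_div; field.
  have dst : w1 * i t + i s != 0.
    have -> : w1 * i t + i s = (w1 + i (s / t)) * i t by rewrite fmorph_div; field.
    exact: mulf_neq0.
  by rewrite -e fmorph_div; field; rewrite it0.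
move=> slz; apply/linear_setP.
have [r [s [t [rst0 onz]]]] : exists r s t,
    [|| r != 0, s != 0 | t != 0] /\ on z (planevec c b w0 w1 r s t).
  case: z slz => [x /= [[r ->]|[r [s ->]]]|_].
  - exists r, 1, 0; rewrite oner_eq0 orbT; split=> //.
    by rewrite /planevec /= rmorph1 rmorph0; apply/eqP; ring.
  - exists r, s, 1; rewrite oner_eq0 !orbT; split=> //.
    rewrite /planevec /= rmorph1; apply/eqP; field.
    exact: den_neq0 ind.
  exists 1, 0, 0; rewrite oner_eq0; split=> //.
  by rewrite /planevec /= !rmorph0 mul0r addr0.
exists (planevec c b w0 w1 r s t); split=> //.
  by apply/planeP; exists r, s, t.
apply: contraTneq rst0 => /(planevec_eq0 c0 ind)[-> -> ->].
by rewrite eqxx.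
Qed.

Definition realized (n : nat) : Prop := exists A B : {set PG1 L},
  [/\ max_scattered_linear_set A, max_scattered_linear_set B, A <> B & #|A :&: B| = n].

(** Two sets of q^2 + q + 1 points with fewer common points are different. *)
Lemma realized_scattered (pi1 pi2 : {vspace V6 L}) n :
  \dim pi1 = 3%N -> scattered pi1 -> \dim pi2 = 3%N -> scattered pi2 ->
  #|linear_set pi1 :&: linear_set pi2| = n -> (n < q ^ 2 + q + 1)%N ->
  realized n.
Proof.
move=> dim1 sc1 dim2 sc2 cn lt_n; exists (linear_set pi1), (linear_set pi2).
split=> //; try exact: scattered_max.
by move=> eq12; move: lt_n; rewrite -cn eq12 setIid card_scattered // ltnn.
Qed.

Lemma realized_share (w0 w1 c b u0 u1 : E) n :
  indep i w0 w1 -> indep i u0 u1 -> c != 0 ->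
  share (slopes i 1 0 w0 w1) (slopes i c b u0 u1) n -> (n < q ^ 2 + q + 1)%N ->
  realized n.
Proof.
move=> indw indu c0 [J [f [f_inj <- sub sup]]].
have one0 := oner_neq0 E.
apply: (@realized_scattered (plane 1 0 w0 w1) (plane c b u0 u1));
  try solve [exact: dim_plane | exact: scattered_plane].
apply: (card_common f_inj) => [z|j].
  move=> /plane_slopesP-/(_ one0 indw) Az /plane_slopesP-/(_ c0 indu) Bz.
  exact: sub.
by have [Aj Bj] := sup j; split; apply/plane_slopesP.
Qed.

Lemma q_gt0 : (0 < q)%N.
Proof. exact: ltnW (finNzRing_gt1 F). Qed.

Lemma exists_notin (s : seq F) : (size s < q)%N -> exists x, x \notin s.
Proof.
move=> lt_s; apply/existsP; apply: contraTT lt_s; rewrite negb_exists => /forallP all_s.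
rewrite -leqNgt; apply: leq_trans (card_size s); apply: subset_leq_card.
by apply/subsetP => x _; have := all_s x; rewrite negbK.
Qed.

(** * Disjoint linear sets from the Frobenius map *)

(** The set {(lam x^q, x)} is already an F-subspace, so that the span adds no
vector; see [frob_planeP]. *)
Definition frob_plane (lam : E) : {vspace V6 L} :=
  <<enum [pred v : E * E | (v.1 == lam * v.2 ^+ q)%R]>>%VS.

Section Frobenius.
Variables (p h : nat).
Hypotheses (p_pr : prime p) (qE : q = (p ^ h)%N) (dimL : \dim {:L} = 3%N).

Lemma pchar_ext : p \in [pchar E].
Proof.
have := card_finPcharP qE p_pr; rewrite !inE => /andP[-> /eqP p0] /=.
by rewrite -(rmorph_nat i) p0 rmorph0.
Qed.

Lemma frobD (x y : E) : (x + y) ^+ q = x ^+ q + y ^+ q.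
Proof.
rewrite exprDn_pchar // qE pnatX; apply/orP; left.
by rewrite pnatE // pchar_ext.
Qed.

Lemma frob_emb a : i a ^+ q = i a.
Proof. by rewrite -rmorphXn /= expf_card. Qed.

Lemma frob_fixed (k : E) : k ^+ q = k -> exists a, k = i a.
Proof.
move=> kq; have : root (map_poly i ('X^q - 'X)) k.
  by rewrite rmorphB /= map_polyXn map_polyX rootE !hornerE kq subrr.
rewrite finField_genPoly rmorph_prod /= rootE horner_prod => /prodf_eq0[a _].
by rewrite rmorphB /= map_polyX map_polyC /= hornerXsubC subr_eq0 => /eqP->; exists a.
Qed.

Lemma frob_planeP lam (v : E * E) : (v \in frob_plane lam) = (v.1 == lam * v.2 ^+ q).
Proof.
apply/idP/idP => [vX|vX]; last by apply: memv_span; rewrite mem_enum.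
rewrite (coord_span (X := in_tuple _) vX).
apply: (big_ind (fun u : V6 L => u.1 == lam * u.2 ^+ q)) =>
  [|[u1 u2] [w1 w2] /= /eqP-> /eqP->|j _].
- by rewrite expr0n gtn_eqF ?q_gt0 // mulr0.
- by rewrite frobD mulrDr.
set e := enum _; have : e`_j \in e by apply: mem_nth.
rewrite mem_enum inE; move: (coord _ _ _) => a; case: e`_j => [x y] /eqP xE.
by rewrite scale_pairE /= exprMn frob_emb mulrCA -xE.
Qed.

Lemma card_ext : #|E| = (q ^ 3)%N.
Proof. by rewrite -dimL -(card_vspace {:E}) card_vspacef. Qed.

Lemma dim_frob_plane lam : \dim (frob_plane lam) = 3%N.
Proof.
have q1 : (1 < q)%N by exact: finNzRing_gt1.
apply/eqP; rewrite -(eqn_exp2l _ _ q1) -card_ext.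
rewrite -(card_vspace (frob_plane lam : {vspace finvect_type (V6 L)})).
pose g (x : E) : finvect_type (V6 L) := (lam * x ^+ q, x).
have g_inj : injective g by move=> x y [].
rewrite -(card_imset predT g_inj); apply/eqP/eq_card => v; rewrite frob_planeP.
apply/eqP/imsetP => [vE|[x _ ->] //]; exists v.2; rewrite // /g -vE.
by case: (v).
Qed.

Lemma frob_plane_snd_neq0 lam (v : E * E) : v \in frob_plane lam -> v != 0 -> v.2 != 0.
Proof.
rewrite frob_planeP => /eqP vE; apply: contraNneq => v20; move: vE.
rewrite v20 expr0n gtn_eqF ?q_gt0 // mulr0 => v10.
by rewrite [v]surjective_pairing v10 v20.
Qed.

(** A ratio k of two vectors of the plane satisfies k^q = k. *)
Lemma scattered_frob_plane lam : lam != 0 -> scattered (frob_plane lam).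
Proof.
move=> lam0 u v k uX vX v0 uv; have v20 := frob_plane_snd_neq0 vX v0.
move: uX vX; rewrite !frob_planeP => /eqP uE /eqP vE.
have [a ->] : exists a, k = i a; last by exists a; rewrite embE.
apply: frob_fixed; apply: (mulIf (expf_neq0 q v20)); apply: (mulfI lam0).
by move: uE; rewrite uv /= vE exprMn => <-; ring.
Qed.

(** x |-> x^(q-1) is not a permutation of the nonzero elements of L, because it
is 1 on the q - 1 > 1 nonzero elements of F; any lam that is not a value of it
gives a plane disjoint from the one for lam = 1. *)
Lemma realized_0 : (2 < q)%N -> realized 0.
Proof.
move=> q2.
have [lam lam0 lamN] : exists2 lam : E, lam != 0 &
    forall k : E, k != 0 -> k ^+ q != lam * k.
  have [a] := exists_notin (s := [:: 0; 1]) q2; rewrite !inE negb_or => /andP[a0 a1].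
  pose D := [set k : E | k != 0]; pose f (k : E) := k ^+ q.-1.
  have : ~~ (D \subset f @: D).
    apply/negP => Df; have /imset_injP f_inj : #|f @: D| == #|D|.
      by rewrite eqn_leq leq_imset_card subset_leq_card.
    case/eqP: a1; apply: (fmorph_inj i); rewrite rmorph1; apply: f_inj.
    - by rewrite inE fmorph_eq0.
    - by rewrite inE oner_eq0.
    have ia0 : i a != 0 by rewrite fmorph_eq0.
    by rewrite /f expr1n; apply: (mulIf ia0); rewrite -exprSr prednK ?q_gt0 // frob_emb mul1r.
  case/subsetPn => lam; rewrite inE => lam0 lamN; exists lam => // k k0.
  apply: contraNneq lamN => klam; apply/imsetP; exists k; rewrite ?inE //.
  by apply: (mulIf k0); rewrite -klam /f -exprSr prednK ?q_gt0.
apply: (@realized_scattered (frob_plane 1) (frob_plane lam));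
  try solve [exact: dim_frob_plane | exact: scattered_frob_plane | by rewrite addn1].
  by apply: scattered_frob_plane; exact: oner_neq0.
apply/eqP; rewrite cards_eq0 -subset0; apply/subsetP => X.
have [pt' _ pt'K] := pt_bij L; rewrite inE -(pt'K X) => /andP[].
move=> /linear_setP[v [vX v0]] sv /linear_setP[u [uX u0]] su.
have u20 := frob_plane_snd_neq0 uX u0; move: vX uX sv su.
rewrite !onP // !frob_planeP => /eqP vE /eqP uE /eqP sv /eqP su.
have /(slope_eqP v0 u0)[k k0 vk] : slope v == slope u by rewrite sv su.
case/eqP: (lamN k k0); apply: (mulIf (expf_neq0 q u20)).
by move: vE; rewrite vk /= uE mul1r exprMn => <-; ring.
Qed.

End Frobenius.

(** * The possible sizes of an intersection *)

Section Generator.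

Hypothesis dimL : \dim {:L} = 3%N.

(** A cubic extension has no intermediate field, so an element outside F has degree 3. *)
Lemma indep_generator (w : E) : (forall a, w != i a) -> indep i w (w ^+ 2).
Proof.
move=> wN r s t e.
pose K : {subfield E} := 1%AS.
have deg3 : adjoin_degree K w = 3%N.
  have := field_dimS (subvf <<K; w>>%AS).
  rewrite dim_Fadjoin dimv1 muln1 dimL => /prime_nt_dvdP-> //.
  rewrite adjoin_deg_eq1; apply/negP => /vlineP[a wa].
  by case/eqP: (wN a); rewrite embE.
pose P : {poly F} := Poly [:: r; s; t].
have rootP : root (map_poly (in_alg E) P) w.
  rewrite rootE (_ : map_poly _ P = map_poly i P); last first.
    by apply: eq_map_poly => a; rewrite embE.
  rewrite map_Poly horner_Poly /=.
  by apply/eqP; rewrite -[RHS]e; ring.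
have := minPoly_dvdp (alg_polyOver K P) rootP.
move/dvdp_leq; rewrite size_minPoly deg3 size_map_poly => sz.
have P0 : P = 0.
  apply/eqP; apply: contraT; rewrite -(map_poly_eq0 (in_alg E)) => /sz.
  by rewrite leqNgt ltnS size_Poly.
by split; [move: (coef_Poly [:: r; s; t] 0) | move: (coef_Poly [:: r; s; t] 1)
  | move: (coef_Poly [:: r; s; t] 2)]; rewrite -/P P0 coef0.
Qed.

Lemma exists_generator : exists w : E, forall a, w != i a.
Proof.
have : ~~ ([set: E] \subset codom i).
  apply/negP => /subset_leq_card; rewrite cardsT (card_ext dimL).
  rewrite card_codom; last exact: fmorph_inj.
  by rewrite leqNgt -[X in (X < _)%N]expn1 ltn_exp2l // finNzRing_gt1.
case/subsetPn => w _ wN; exists w => a; apply: contraNneq wN => ->; exact: codom_f.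
Qed.

Lemma indep_coords (w0 w1 : E) : indep i w0 w1 ->
  forall x, exists r s t, x = i r + i s * w0 + i t * w1.
Proof.
move=> ind x.
pose g (u : F * F * F) := i u.1.1 + i u.1.2 * w0 + i u.2 * w1.
have g_inj : injective g.
  move=> [[r s] t] [[r' s'] t'] /= /eqP; rewrite -subr_eq0 => /eqP e.
  have [] := ind (r - r') (s - s') (t - t'); first by rewrite -[RHS]e /g /=; ring.
  by move=> /subr0_eq-> /subr0_eq-> /subr0_eq->.
have : x \in codom g.
  by apply: inj_card_onto => //; rewrite !card_prod (card_ext dimL) !expnS muln1 mulnA.
by case/codomP=> [[[r s] t] ->]; exists r, s, t.
Qed.

Lemma generator_relation (w : E) : indep i w (w ^+ 2) ->
  exists t0 t1 t2, t0 != 0 /\ w ^+ 3 = i t2 * w ^+ 2 + i t1 * w + i t0.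
Proof.
move=> ind; have [t0 [t1 [t2 w3]]] := indep_coords ind (w ^+ 3).
exists t0, t1, t2; split; last by rewrite w3; ring.
apply/eqP => t00; have w0 := indep_neq0 ind.
have [] := ind (- t1) (- t2) 1; last by move=> _ _ /eqP; rewrite oner_eq0.
apply: (mulfI w0); rewrite mulr0.
transitivity (w ^+ 3 - (i t0 + i t1 * w + i t2 * w ^+ 2)).
  by rewrite t00 rmorph0 rmorph1 !rmorphN; ring.
by rewrite w3 subrr.
Qed.

(** x^2 + e x takes the value 0 at 0 and at -e, so it misses some value. *)
Lemma exists_anisotropic (e : F) : e != 0 ->
  exists n : F, forall x, x ^+ 2 + e * x - n != 0.
Proof.
move=> e0; pose f (x : F) := x ^+ 2 + e * x.
have : ~~ ([set: F] \subset f @: F).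
  apply/negP => sub; have /imset_injP f_inj : #|f @: F| == #|F|.
    by rewrite eqn_leq leq_imset_card -[X in (X <= _)%N]cardsT subset_leq_card.
  case/eqP: e0; apply/esym/oppr_inj; rewrite oppr0; apply: f_inj; rewrite // /f; ring.
case/subsetPn => n _ nN; exists n => x; rewrite subr_eq0.
by apply: contraNneq nN => <-; apply/imsetP; exists x.
Qed.

Lemma card_neq0 : #|[pred x : F | x != 0]| = q.-1.
Proof. by rewrite (cardD1 0 F) /=; apply: eq_card => x; rewrite !inE andbT. Qed.

Lemma indep_inv (w : E) : indep i w (w ^+ 2) -> indep i w w^-1.
Proof.
move=> ind; have w0 := indep_neq0 ind.
move=> r s t e; have [] := ind t r s; last by [].
by rewrite -[RHS](mulr0 w) -[in RHS]e; field.
Qed.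

Lemma lt_card_linear_set n : (n <= 2 * q + 2)%N -> (n < q ^ 2 + q + 1)%N.
Proof.
move=> le_n; apply: leq_ltn_trans le_n _; have := finNzRing_gt1 F.
move: q => k; rewrite expnS expn1; nia.
Qed.

Lemma realized_2q : (2 < q)%N -> realized (2 * q).
Proof.
move=> q2; have [w /indep_generator ind] := exists_generator.
have ind' := indep_inv ind.
have [a] := exists_notin (s := [:: 0; -1]) q2; rewrite !inE negb_or => /andP[a0 a1].
have {}a1 : a + 1 != 0 by rewrite addr_eq0.
apply: (realized_share ind' _ (oner_neq0 E) (share_2q ind' a0 a1));
  last by apply: lt_card_linear_set; lia.
move=> r s t e; have [] := ind' r (s * a) (t * (a + 1)).
  by rewrite -[RHS]e; ring.
move=> -> /eqP + /eqP; rewrite !mulf_eq0 (negPf a0) (negPf a1) !orbF.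
by move=> /eqP-> /eqP->.
Qed.

Lemma realized_2q_plus1 : realized (2 * q + 1).
Proof.
have [w /indep_generator ind] := exists_generator.
apply: (realized_share ind _ (oner_neq0 E) (share_2q_plus1 ind));
  last by apply: lt_card_linear_set; lia.
move=> r s t e; have [] := ind r (s + t) t; first by rewrite -[RHS]e; ring.
by move=> -> + t0; rewrite t0 addr0.
Qed.

Lemma realized_2q_plus2 : realized (2 * q + 2).
Proof.
have [w /indep_generator ind] := exists_generator.
have [n irr] := exists_anisotropic (oner_neq0 F).
have shareG := share_2q_plus2 ind irr.
set G := w ^+ 2 + i 1 * w + i (- n) in shareG.
have n0 : - n != 0 by have := irr 0; rewrite expr0n /= mulr0 !add0r.
have G0 : G != 0.
  apply/eqP => e; have [] := ind (- n) 1 1; first by rewrite -[RHS]e /G rmorph1; ring.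
  by move=> _ /eqP; rewrite oner_eq0.
have G0' : w ^+ 2 + w - i n != 0 by move: G0; rewrite /G rmorph1 mul1r rmorphN.
apply: (realized_share _ _ (oner_neq0 E) shareG); last by apply: lt_card_linear_set.
  move=> r s t e; have [] := ind (t + r * - n) (s + r) r.
    by rewrite -[RHS](mulr0 G) -[in RHS]e /G; field.
  by move=> + + r0; rewrite r0 !mul0r !addr0.
move=> r s t e; have [] := ind (r * - n + t - s * - n) (r + t) r.
  by rewrite -[RHS](mulr0 G) -[in RHS]e /G; field.
move=> + + r0; rewrite r0 mul0r !add0r => e1 t0; move: e1; rewrite t0 sub0r => /eqP.
by rewrite oppr_eq0 mulf_eq0 (negPf n0) orbF => /eqP.
Qed.

Lemma realized_triangular (a d j : F) n :
  a != 0 -> a != 1 -> d != 0 -> d != 1 -> a + d != 1 ->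
  #|[pred s : F | (d - a) * s != j]|.+1 = n -> realized n.
Proof.
move=> a0 a1 d0 d1 ad1 <-.
have [w /indep_generator ind] := exists_generator.
have [t0 [t1 [t2 [_ w3]]]] := generator_relation ind.
have ind' := indepC ind.
apply: (realized_share ind' ind' _ (share_triangular j ind' w3 a0 a1 d0 d1 ad1)).
  by rewrite fmorph_eq0 subr_eq0.
apply: lt_card_linear_set; apply: leq_trans (_ : q.+1 <= _)%N; last by lia.
by rewrite ltnS max_card.
Qed.

Lemma exists_not_0_1_half : (3 < q)%N -> exists a : F, [/\ a != 0, a != 1 & a + a != 1].
Proof.
move=> q3; have [a] := exists_notin (s := [:: 0; 1; 2%:R^-1]) q3.
rewrite !inE !negb_or => /and3P[a0 a1 a2]; exists a; split=> //.
apply: contraNneq a2 => aa; have a2 : a * 2%:R = 1 by rewrite mulr_natr mulr2n.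
have two0 : 2%:R != 0 :> F by apply: contraTneq (oner_neq0 F) => e; rewrite -a2 e mulr0 eqxx.
by apply/eqP/(mulIf two0); rewrite a2 mulVf.
Qed.

(** The identity projectivity fixes every parameter, so that only infinity is
common. *)
Lemma realized_1 : (3 < q)%N -> realized 1.
Proof.
move=> /exists_not_0_1_half[a [a0 a1 a2]].
apply: (realized_triangular (j := 0) a0 a1 a0 a1 a2).
by congr S; apply: eq_card0 => s; rewrite !inE subrr mul0r eqxx.
Qed.

(** A Jordan block: infinity is the only fixed parameter. *)
Lemma realized_q_plus1 : (3 < q)%N -> realized (q + 1).
Proof.
move=> /exists_not_0_1_half[a [a0 a1 a2]].
apply: (realized_triangular (j := 1) a0 a1 a0 a1 a2).
by rewrite addn1; congr S; apply: eq_card => s; rewrite !inE subrr mul0r eq_sym oner_eq0.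
Qed.

(** A diagonal projectivity, which fixes 0 and infinity.  The element d avoids
four values, hence the bound on q. *)
Lemma realized_q : (4 < q)%N -> realized q.
Proof.
move=> q4; have [a] := exists_notin (s := [:: 0; 1]) (ltnW (ltnW q4)).
rewrite !inE negb_or => /andP[a0 a1].
have [d] := exists_notin (s := [:: 0; 1; a; 1 - a]) q4.
rewrite !inE !negb_or => /and4P[d0 d1 da d1a].
apply: (realized_triangular (j := 0) a0 a1 d0 d1).
  by apply: contraNneq d1a => ad; apply/eqP; rewrite -ad; ring.
rewrite -[RHS](prednK q_gt0) -card_neq0; congr S; apply: eq_card => s.
by rewrite !inE mulf_eq0 subr_eq0 (negPf da).
Qed.

Lemma realized_q_plus2 : (2 < q)%N -> realized (q + 2).
Proof.
move=> q2; have [w /indep_generator ind] := exists_generator.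
have [t0 [t1 [t2 [t00 w3]]]] := generator_relation ind.
have [e] := exists_notin (s := [:: 0; 1]) q2; rewrite !inE negb_or => /andP[e0 e1].
have [n irr] := exists_anisotropic e0.
have ind' := indepC (indep_inv ind).
have w0 := indep_neq0 ind.
have w2 : w ^+ 2 = i t2 * w + i t1 + i t0 / w.
  by apply: (mulIf w0); rewrite -exprSr w3; field.
apply: (realized_share ind' ind' _ (share_q_plus2 ind' w2 t00 e1 irr)).
  by rewrite fmorph_eq0 subr_eq0 eq_sym.
by apply: lt_card_linear_set; lia.
Qed.

(** Additive Hilbert 90: in characteristic 3 the polynomial x^9 + x^3 + x has at
most 9 < 27 roots, so some th has nonzero trace T, and the w below is the
usual solution of w^3 - w = -1. *)
Lemma exists_artin_schreier : q = 3%N -> 1 + 1 + 1 = 0 :> E ->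
  exists w : E, w ^+ 3 = w - 1.
Proof.
move=> q3 char3E.
have cubeD (x y : E) : (x + y) ^+ 3 = x ^+ 3 + y ^+ 3.
  by rewrite -q3 (frobD (p := 3) (h := 1)).
have [th T0] : exists th : E, th ^+ 9 + (th ^+ 3 + th) != 0.
  pose P : {poly E} := 'X^9 + ('X^3 + 'X).
  have sP : size P = 10%N.
    have s4 : size ('X^3 + 'X : {poly E}) = 4%N.
      by rewrite size_polyDl size_polyXn // size_polyX.
    by rewrite /P size_polyDl size_polyXn ?s4.
  have P0 : P != 0 by rewrite -size_poly_eq0 sP.
  have /allPn[th _ rootN] : ~~ all (root P) (enum E).
    apply/negP => /(max_poly_roots P0)/(_ (enum_uniq E)).
    by rewrite sP -cardE (card_ext dimL) q3.
  by exists th; move: rootN; rewrite rootE /P !hornerE.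
pose T := th ^+ 9 + (th ^+ 3 + th).
have th27 : th ^+ 27 = th.
  by have := expf_card th; rewrite (card_ext dimL) q3.
have T3 : T ^+ 3 = T.
  by rewrite /T !cubeD -!exprM th27; ring.
exists ((th ^+ 3 - th ^+ 9) / T).
have cubeN (x : E) : (- x) ^+ 3 = - x ^+ 3 by ring.
rewrite expr_div_n T3 cubeD cubeN -!exprM th27.
apply/eqP; rewrite -subr_eq0; apply/eqP.
transitivity ((1 + 1 + 1) * th ^+ 9 / T); last by rewrite char3E !mul0r.
by move: (T0); rewrite /T => ?; field.
Qed.

Lemma realized_4 : q = 3%N -> realized 4.
Proof.
move=> q3.
have pc3 : 3%N \in [pchar F] by apply: (@card_finPcharP F 3 1).
have char3 : 1 + 1 + 1 = 0 :> F.
  by rewrite -[RHS](pcharf0 pc3) !mulrS mulr0n addr0 addrA.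
have char3E : 1 + 1 + 1 = 0 :> E.
  by rewrite -[1](rmorph1 i) -!rmorphD char3 rmorph0.
have F3 (x : F) : [|| x == 0, x == 1 | x == -1].
  apply: contraT; rewrite !negb_or => /and3P[x0 x1 xN1].
  have uniq4 : uniq [:: x; 0; 1; -1].
    rewrite /= !inE !negb_or x0 x1 xN1 eq_sym oner_eq0 eq_sym oppr_eq0 oner_eq0 /= andbT.
    apply: contraNneq (oner_neq0 F) => e; have e2 : 1 + 1 = 0 :> F by rewrite {1}e addNr.
    by move: char3; rewrite e2 add0r => ->.
  have := max_card [in [:: x; 0; 1; -1]].
  by rewrite (card_uniqP uniq4) q3.
have [w w3] := exists_artin_schreier q3 char3E.
have wN a : w != i a.
  apply/eqP => wa; case/eqP: (oner_neq0 E).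
  have : i a ^+ 3 = i a - 1 by rewrite -wa.
  rewrite -q3 frob_emb => e; apply/oppr_inj; rewrite oppr0.
  by apply: (addrI (i a)); rewrite addr0.
have ind := indepC (indep_generator wN).
have w1 : w - 1 != 0 by rewrite subr_eq0 -(rmorph1 i) wN.
apply: (realized_share ind ind w1 (share_4 ind w3 F3 char3)).
by rewrite q3.
Qed.

End Generator.

End PlaneSlopes.

(** * The theorem *)

Theorem corollary8 (p h q x : nat) (hp : prime p) (hh : 0 < h) (hq : q = p ^ h)
    (F : finFieldType) (hF : #|F| = q)
    (L : fieldExtType F) (hL : \dim {:L} = 3)
    (hx : x \in [:: 0; 1; q; q + 1; q + 2; 2 * q; 2 * q + 1; 2 * q + 2])
    (hexc2 : ~ (q = 2 /\ x \in [:: 0; 1; 2; 3; 4]))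
    (hexc3 : ~ (q = 3 /\ x \in [:: 1; 3]))
    (hexc4 : ~ (q = 4 /\ x = 4)) :
  exists A B : {set PG1 L},
    [/\ max_scattered_linear_set A,
        max_scattered_linear_set B,
        A <> B
      & #|A :&: B| = x].
Proof.
rewrite -{q}hF in hq hx hexc2 hexc3 hexc4.
have q_gt1 : 1 < #|F| := finNzRing_gt1 F.
have q_neq2 : x \in [:: 0; 1; 2; 3; 4] -> #|F| <> 2 by move=> x2 q2; apply: hexc2.
have q_neq3 : x \in [:: 1; 3] -> #|F| <> 3 by move=> x3 q3; apply: hexc3.
have q_neq4 : x = 4 -> #|F| <> 4 by move=> x4 q4; apply: hexc4.
rewrite -/(realized L x); move: hx; rewrite !inE.
case/or4P =>
    [/eqP ex|/eqP ex|/eqP ex|/or4P[/eqP ex|/eqP ex|/eqP ex|/orP[/eqP ex|/eqP ex]]];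
  rewrite !inE ex in q_neq2 q_neq3 q_neq4 *.
- by apply: (realized_0 hp hq hL); lia.
- by apply: realized_1; lia.
- by apply: realized_q; lia.
- have [q3|q3] : #|F| = 3 \/ 3 < #|F| by lia.
    by rewrite q3; apply: realized_4.
  exact: realized_q_plus1.
- by apply: realized_q_plus2; lia.
- by apply: realized_2q; lia.
- exact: realized_2q_plus1.
exact: realized_2q_plus2.
Qed.
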